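(* Let $A\in\mathbb{R}^{m\times n}$, $k\le l\le \min(m,n)$, and let $V\in\mathbb{R}^{n\times l}$ be a full-rank matrix such that $AV$ has full column rank. (i) The algorithm PRR_RLU run with $V$ and selecting the row-permutation block $P_1$ (with $P_1AV$ invertible) produces the same approximation $A_k$ of $A$ as the algorithm RLU run with the same $V$ and with $U:=P_1$. (ii) The algorithm RQR run with $V$, with orthonormal factor $T$, produces the same approximation $A_k$ of $A$ as the algorithm RLU run with the same $V$ and with $U:=T^T$.
   Context: The algorithms compute the following approximations $A_k$ of $A$. RLU: given $V\in\mathbb{R}^{n\times l}$ and $U\in\mathbb{R}^{l\times m}$, both of full rank, with $UAV$ invertible, set $T=AV$, $S=UA$, $\hat A=UAV$; the approximation is $A_k=T\hat A^{-1}S$. PRR_RLU (randomized LU with row selection): given $V\in\mathbb{R}^{n\times l}$, compute the thin QR factorization $AV=QR$ with $Q\in\mathbb{R}^{m\times l}$ having orthonormal columns; select a permutation matrix $P\in\mathbb{R}^{m\times m}$ such that, writing $PQ=\begin{pmatrix}\bar Q_{11}\\\bar Q_{21}\end{pmatrix}$ with $\bar Q_{11}$ of size $l\times l$ (invertible), the max-norm $\|\bar Q_{21}\bar Q_{11}^{-1}\|_{\max}$ is bounded by a small constant; let $P_1$ be the first $l$ rows of $P$, so $\bar Q_{11}=P_1Q$. Set $T=P^T\begin{pmatrix}I\\\bar Q_{21}\bar Q_{11}^{-1}\end{pmatrix}$ and $S=P_1A$; the approximation is $A_k=TS$. RQR (randomized QR): given $V\in\mathbb{R}^{n\times l}$,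 compute the thin QR factorization of $AV$ with orthonormal factor $T\in\mathbb{R}^{m\times l}$; set $S=T^TA$; the approximation is $A_k=TS$. *)

(* Defs.v *)
From HB Require Import structures.
From mathcomp Require Import all_boot all_order all_algebra.
From mathcomp Require Import reals matrix_normedtype.

Set Implicit Arguments.
Unset Strict Implicit.
Unset Printing Implicit Defensive.

Import Order.TTheory GRing.Theory Num.Theory.

Local Open Scope ring_scope.

Section RowBlocks.
Context {R : realType} {m l p : nat}.

Definition top_rows (hlm : (l <= m)%N) (B : 'M[R]_(m, p)) : 'M[R]_(l, p) :=
  usubmx (castmx (esym (subnKC hlm), erefl p) B).

Definition bottom_rows (hlm : (l <= m)%N) (B : 'M[R]_(m, p)) :
    'M[R]_(m - l, p) :=
  dsubmx (castmx (esym (subnKC hlm), erefl p) B).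

Definition stack_rows (hlm : (l <= m)%N)
    (B1 : 'M[R]_(l, p)) (B2 : 'M[R]_(m - l, p)) : 'M[R]_(m, p) :=
  castmx (subnKC hlm, erefl p) (col_mx B1 B2).

End RowBlocks.

Definition full_rank {R : realType} {m n : nat} (B : 'M[R]_(m, n)) : Prop :=
  \rank B = minn m n.

(* [is_trig_mx] means lower triangular, hence the transpose. *)
Definition thin_QR {R : realType} {m l : nat}
    (B Q : 'M[R]_(m, l)) (Rf : 'M[R]_l) : Prop :=
  [/\ Q^T *m Q = 1%:M, is_trig_mx Rf^T & B = Q *m Rf].

(* Each algorithm is the relation "on this input, with these choices, it runs
   and returns [Ak]", so the requirements on the input and on the choices made
   along the way are part of it. *)

Definition RLU {R : realType} {m n l : nat} (A : 'M[R]_(m, n))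
    (V : 'M[R]_(n, l)) (U : 'M[R]_(l, m)) (Ak : 'M[R]_(m, n)) : Prop :=
  let T := A *m V in
  let S := U *m A in
  let Ahat := U *m A *m V in
  [/\ full_rank V, full_rank U, Ahat \in unitmx & Ak = T *m invmx Ahat *m S].

(* [c] is the constant bounding the max-norm ([mx_norm] is the largest absolute
   value of an entry). *)
Definition PRR_RLU {R : realType} {m n l : nat} (hlm : (l <= m)%N) (c : R)
    (A : 'M[R]_(m, n)) (V : 'M[R]_(n, l)) (P : 'M[R]_m)
    (Ak : 'M[R]_(m, n)) : Prop :=
  exists Q Rf, thin_QR (A *m V) Q Rf /\
  let Q11 := top_rows hlm (P *m Q) in
  let Q21 := bottom_rows hlm (P *m Q) in
  let P1 := top_rows hlm P in
  let T := P^T *m stack_rows hlm 1%:M (Q21 *m invmx Q11) in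
  let S := P1 *m A in
  [/\ is_perm_mx P, Q11 \in unitmx, mx_norm (Q21 *m invmx Q11) <= c
    & Ak = T *m S].

Definition RQR {R : realType} {m n l : nat} (A : 'M[R]_(m, n))
    (V : 'M[R]_(n, l)) (T : 'M[R]_(m, l)) (Ak : 'M[R]_(m, n)) : Prop :=
  let S := T^T *m A in
  (exists Rf, thin_QR (A *m V) T Rf) /\ Ak = T *m S.

(* Main.v *)
Require Import Defs.
From HB Require Import structures.
From mathcomp Require Import all_boot all_order all_algebra.
From mathcomp Require Import fingroup perm.
From mathcomp Require Import reals matrix_normedtype.

(** All three algorithms project the columns of [A] onto the column space of
    [A *m V], and the projection is determined by its range and by the
    functionals (the rows of [U]) that it preserves.  Concretely, the factor
    [A *m V *m invmx (U *m A *m V)] of the randomized LU approximation is the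
    only matrix whose columns lie in that space and that [U] maps to the
    identity.  It can therefore be computed from any other basis [W] of the
    space, [A *m V = W *m M], as [W *m invmx (U *m W)] (lemma
    [mulmx_invmx_basis]), and the approximation is
    [W *m invmx (U *m W) *m (U *m A)] (lemma [RLU_basis]).

    Now take for [W] the orthonormal factor of a QR factorization of [A *m V].
    With [U] the selected rows [P1] of the permutation, [U *m W] is the block
    [Q11], and undoing the permutation on [col_mx 1 (Q21 *m invmx Q11)] gives
    exactly [W *m invmx Q11] (lemma [unpermuted_stack]).  With [U] equal to
    [W^T], [U *m W] is the identity and the projection is orthogonal. *)

Local Open Scope ring_scope.

Lemma top_rows_mul (R : realType) (m l p q : nat) (hlm : (l <= m)%N)
    (B : 'M[R]_(m, p)) (C : 'M[R]_(p, q)) :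
  top_rows hlm (B *m C) = top_rows hlm B *m C.
Proof.
apply/matrixP => i j; rewrite !(mxE, castmxE) /=.
by apply: eq_bigr => s _; rewrite !(mxE, castmxE) /= !cast_ord_id.
Qed.

Lemma stack_rows_mul (R : realType) (m l p q : nat) (hlm : (l <= m)%N)
    (B1 : 'M[R]_(l, p)) (B2 : 'M[R]_(m - l, p)) (C : 'M[R]_(p, q)) :
  stack_rows hlm B1 B2 *m C = stack_rows hlm (B1 *m C) (B2 *m C).
Proof.
rewrite /stack_rows -mul_col_mx; apply/matrixP => i j.
rewrite castmxE !mxE; apply: eq_bigr => s _.
by rewrite castmxE /= !cast_ord_id.
Qed.

Lemma stack_top_bottom_rows (R : realType) (m l p : nat) (hlm : (l <= m)%N)
    (B : 'M[R]_(m, p)) :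
  stack_rows hlm (top_rows hlm B) (bottom_rows hlm B) = B.
Proof.
by rewrite /stack_rows /top_rows /bottom_rows vsubmxK castmx_comp castmx_id.
Qed.

Lemma trmx_perm_mulK (R : pzRingType) (m p : nat) (P : 'M[R]_m)
    (B : 'M[R]_(m, p)) :
  is_perm_mx P -> P^T *m (P *m B) = B.
Proof.
case/is_perm_mxP => s ->; rewrite tr_perm_mx mulmxA -perm_mxM.
by rewrite mulVg perm_mx1 mul1mx.
Qed.

(** Since the identity block is [Q11 *m invmx Q11], the stacked matrix is all
    of [P *m Q] times [invmx Q11], and the permutation cancels. *)
Lemma unpermuted_stack (R : realType) (m l : nat) (hlm : (l <= m)%N)
    (P : 'M[R]_m) (Q : 'M[R]_(m, l)) (Q11 := top_rows hlm (P *m Q)) :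
  is_perm_mx P -> Q11 \in unitmx ->
  P^T *m stack_rows hlm 1%:M (bottom_rows hlm (P *m Q) *m invmx Q11)
    = Q *m invmx Q11.
Proof.
move=> permP uQ; rewrite -(mulmxV uQ) -stack_rows_mul stack_top_bottom_rows.
by rewrite mulmxA trmx_perm_mulK.
Qed.

(** Changing the basis by [M] on the right turns [U *m W] into [U *m W *m M],
    whose inverse cancels [M]. *)
Lemma mulmx_invmx_basis (R : comUnitRingType) (m l : nat)
    (U : 'M[R]_(l, m)) (W : 'M[R]_(m, l)) (M : 'M[R]_l) :
  U *m (W *m M) \in unitmx ->
  W *m M *m invmx (U *m (W *m M)) = W *m invmx (U *m W).
Proof.
move=> uUWM.
have /andP[uUW _] : (U *m W \in unitmx) && (M \in unitmx).
  by rewrite -unitmx_mul -mulmxA.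
apply: (can_inj (mulmxK uUWM)).
by rewrite /= mulmxKV // (mulmxA U) (mulmxA _ (U *m W)) mulmxKV.
Qed.

Lemma full_rank_unit_mul (R : realType) (m l : nat) (U : 'M[R]_(l, m))
    (B : 'M[R]_(m, l)) :
  U *m B \in unitmx -> full_rank U.
Proof.
move=> uUB; have rU : \rank U = l.
  by apply/eqP; rewrite eqn_leq rank_leq_row -{1}(mxrank_unit uUB) mxrankM_maxl.
by rewrite /full_rank rU; apply/esym/minn_idPl; rewrite -{1}rU rank_leq_col.
Qed.

Lemma RLU_basis (R : realType) (m n l : nat) (A : 'M[R]_(m, n))
    (V : 'M[R]_(n, l)) (U : 'M[R]_(l, m)) (W : 'M[R]_(m, l)) (M : 'M[R]_l) :
  full_rank V -> U *m A *m V \in unitmx -> A *m V = W *m M ->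
  RLU A V U (W *m invmx (U *m W) *m (U *m A)).
Proof.
rewrite -mulmxA => rV uUAV eAV; split; rewrite -?mulmxA //.
  exact: full_rank_unit_mul uUAV.
rewrite !mulmxA; congr (_ *m _ *m _).
by rewrite -!(mulmxA _ A V) eAV mulmx_invmx_basis -?eAV.
Qed.

Theorem proposition3p1 (R : realType) (m n k l : nat)
    (hkl : (k <= l)%N) (hlm : (l <= m)%N) (hln : (l <= n)%N)
    (A : 'M[R]_(m, n)) (V : 'M[R]_(n, l))
    (hV : full_rank V)
    (* [row_full] is rank = number of columns *)
    (hAV : row_full (A *m V)) :
  (forall (c : R) (P : 'M[R]_m) (Ak : 'M[R]_(m, n)),
     top_rows hlm P *m A *m V \in unitmx ->
     PRR_RLU hlm c A V P Ak ->
     RLU A V (top_rows hlm P) Ak)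
  /\
  (forall (T : 'M[R]_(m, l)) (Ak : 'M[R]_(m, n)),
     RQR A V T Ak ->
     RLU A V T^T Ak).
Proof.
split=> [c P Ak uPAV [Q [Rf [[_ _ eAV] [permP uQ11 _ ->]]]]|].
  rewrite unpermuted_stack // top_rows_mul.
  exact: RLU_basis eAV.
move=> T Ak [[Rf [TT _ eAV]] ->].
have -> : T *m (T^T *m A) = T *m invmx (T^T *m T) *m (T^T *m A).
  by rewrite TT invmx1 mulmx1.
apply: (@RLU_basis _ _ _ _ _ _ _ _ Rf) => //.
(* As [T] has orthonormal columns, [T^T *m A *m V] is the triangular factor
   [Rf], and its rank is at least that of [T *m Rf], namely [l]. *)
rewrite -mulmxA eAV mulmxA TT mul1mx -row_full_unit.
rewrite /row_full eqn_leq rank_leq_col /=.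
by move: hAV; rewrite /row_full eAV => /eqP {1}<-; apply: mxrankM_maxr.
Qed.
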